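(* For all integers $1\le l<m$, all prime powers $q$, and all $r=1,\dots,k$ with $k=\binom{m}{l}$, we have $$d_r\le D_r .$$
   Context: Let $V$ be an $m$-dimensional vector space over $F_q$ with basis $e_1,\dots,e_m$ and $A_i=\mathrm{Span}(e_1,\dots,e_i)$. $G(l,m)$ is the Grassmann variety of $l$-dimensional subspaces of $V$, embedded in $\mathbf P^{k-1}$ by Plücker coordinates, with $n$ $F_q$-rational points. For $\alpha=(a_1,\dots,a_l)$ with $1\le a_1<\dots<a_l\le m$, the Schubert cycle is $S_\alpha=\{W\in G(l,m):\dim(W\cap A_{a_i})\ge i\ \forall i\}$; a Schubert union is a finite (possibly empty) union of Schubert cycles with respect to this fixed flag. $J_r$ is the maximum number of $F_q$-rational points in a Schubert union spanning a linear space of codimension at least $r$ in the Plücker space $\mathbf P^{k-1}$, and $D_r=n-J_r$. The Grassmann code $C(l,m)$ is the linear $[n,k]$-code over $F_q$ (up to equivalence) having as generator matrix a $k\times n$ matrix whose columns are representatives in $(F_q)^k$ of the $n$ $F_q$-rational points of $G(l,m)$. $d_r$ is its $r$-th higher weight: the minimum cardinality of the support of an $r$-dimensional subcode; equivalently $d_r=n-H_r$, where $H_r$ is the maximum number of $F_q$-points of $G(l,m)$ contained in a codimension $r$ linear subspace of $\mathbf P^{k-1}$. *)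

(* Defs.v *)
From HB Require Import structures.
From mathcomp Require Import all_boot all_order all_algebra.

Set Implicit Arguments.
Unset Strict Implicit.
Unset Printing Implicit Defensive.

Import GRing.Theory.
Local Open Scope ring_scope.

Section FiniteVspace.
Import VectorInternalTheory.
Variables (F : finFieldType) (V : vectType F).
HB.instance Definition _ := [Countable of {vspace V} by <:].
HB.instance Definition _ := [Finite of {vspace V} by <:].
End FiniteVspace.

(* Sequences 1 <= a_1 < ... < a_l <= m. Everything is shifted by one:
   position i : 'I_l carries the value a_(i+1) - 1 : 'I_m. *)
Definition schubert_index (l m : nat) :=
  {a : l.-tuple 'I_m | sorted ltn (map val a)}.

Lemma card_schubert_index l m : #|{: schubert_index l m}| = 'C(m, l).
Proof.
by rewrite card_sig -card_ltn_sorted_tuples; apply: eq_card => a; rewrite !inE.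
Qed.

Definition pluecker_index l m (i : 'I_'C(m, l)) : schubert_index l m :=
  enum_val (cast_ord (esym (card_schubert_index l m)) i).

Section Grassmannian.

Variables (F : finFieldType) (l m : nat) (V : vectType F) (e : m.-tuple V).

Definition grassmannian : {set {vspace V}} := [set W | \dim W == l].

(* The maximal minors of the l x m matrix of the coordinates of b in e. *)
Definition pluecker_coords (b : seq V) : 'cV[F]_('C(m, l)) :=
  \col_p \det (\matrix_(i < l, j < l)
                 coord e (tnth (val (pluecker_index p)) j) b`_i).

(* Points of the projective space are the lines of 'cV_('C(m, l)); for W in
   the Grassmannian the line does not depend on the chosen basis of W. *)
Definition pluecker_point (W : {vspace V}) : {vspace 'cV[F]_('C(m, l))} :=
  <[pluecker_coords (vbasis W)]>%VS.

Definition flag (i : nat) : {vspace V} := <<take i e>>%VS.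

Definition schubert_cycle (a : schubert_index l m) : {set {vspace V}} :=
  [set W in grassmannian |
    [forall i : 'I_l, (i.+1 <= \dim (W :&: flag (tnth (val a) i).+1))%N]].

Definition schubert_union (S : {set schubert_index l m}) : {set {vspace V}} :=
  \bigcup_(a in S) schubert_cycle a.

Definition pluecker_span (X : {set {vspace V}}) :
    {vspace 'cV[F]_('C(m, l))} :=
  (\sum_(W in X) pluecker_point W)%VS.

(* Linear dimensions: the projective codimension is (k - 1) - (\dim _ - 1),
   with k = 'C(m, l); the empty set spans a space of codimension k. *)
Definition pluecker_codim (X : {set {vspace V}}) : nat :=
  'C(m, l) - \dim (pluecker_span X).

Definition schubert_J (r : nat) : nat :=
  \max_(S : {set schubert_index l m} |
          (r <= pluecker_codim (schubert_union S))%N) #|schubert_union S|.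

Definition schubert_D (r : nat) : nat := #|grassmannian| - schubert_J r.

(* The Grassmann code is defined only up to equivalence: any ordering of the
   points and any choice of representatives are allowed. *)
Definition grassmann_generator_matrix
    (G : 'M[F]_('C(m, l), #|grassmannian|)) : Prop :=
  exists w : 'I_#|grassmannian| -> {vspace V},
    [/\ injective w, forall j, w j \in grassmannian
      & forall j, <[col j G]>%VS = pluecker_point (w j)].

End Grassmannian.

Definition code_of_generator (F : fieldType) k n (G : 'M[F]_(k, n)) :
    {vspace 'rV[F]_n} :=
  <<[seq row i G | i : 'I_k]>>%VS.

Section HigherWeight.

Variables (F : finFieldType) (n : nat).

Definition code_support (D : {vspace 'rV[F]_n}) : {set 'I_n} :=
  [set j | [exists c : 'rV[F]_n, (c \in D) && (c 0 j != 0)]].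

(* Supports have at most n elements, so the default value n does not affect
   the minimum when r is at most the dimension of C. *)
Definition higher_weight (C : {vspace 'rV[F]_n}) (r : nat) : nat :=
  \big[minn/n]_(D : {vspace 'rV[F]_n} | (D <= C)%VS && (\dim D == r))
    #|code_support D|.

End HigherWeight.

(* Main.v *)
Require Import Defs.
From mathcomp Require Import all_boot all_order all_algebra.

(** The columns of a generator matrix of the Grassmann code represent the
    rational points of G(l,m), so a linear form u on the Pluecker space gives
    the codeword u *m G, whose entry at a point W vanishes exactly when W lies
    on the hyperplane u = 0.  Let X be a set of points whose linear span L has
    codimension at least r.  The forms vanishing on L make up a space of
    dimension at least r ([annihilator_exists]); the codewords of r independent
    ones vanish at all points of X, so their supports avoid X.  As soon as these
    codewords are still independent they span an r-dimensional subcode with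
    support of size at most n - #|X| ([higher_weight_le_codim]).

    Independence means that no nonzero form vanishes on all of G(l,m), i.e. that
    the Grassmannian spans the Pluecker space ([generator_inj]).  It does: for
    every Schubert index a, the coordinate subspace spanned by the e_i with i in
    a has a nonzero Pluecker coordinate at a and nowhere else.

    Taking for X a Schubert union that realises J_r gives d_r <= n - J_r. *)

Set Implicit Arguments.
Unset Strict Implicit.
Unset Printing Implicit Defensive.

Import GRing.Theory.
Local Open Scope ring_scope.

Lemma higher_weight_le (F : finFieldType) n (C D : {vspace 'rV[F]_n}) r :
  (D <= C)%VS -> \dim D = r -> (higher_weight C r <= #|code_support D|)%N.
Proof.
move=> sDC dimD; rewrite /higher_weight -minEnat -leEnat.
by apply: Order.TotalTheory.bigmin_le_cond; rewrite sDC dimD eqxx.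
Qed.

Lemma subv_of_dim (F : fieldType) (V : vectType F) (U : {vspace V}) r :
  (r <= \dim U)%N -> exists2 U' : {vspace V}, (U' <= U)%VS & \dim U' = r.
Proof.
move=> le_r_U; exists <<take r (vbasis U)>>%VS.
  apply/span_subvP=> v /mem_take; exact: vbasis_mem.
have free_take: free (take r (vbasis U)).
  apply: (@catl_free _ _ (drop r (vbasis U))).
  by rewrite cat_take_drop (basis_free (vbasisP U)).
by move/eqP: free_take => ->; rewrite size_takel // size_tuple.
Qed.

(** The forms that vanish on a spanning family of d = \dim L vectors are the
    kernel of a linear map into a space of dimension d. *)
Lemma annihilator_exists (F : fieldType) k (L : {vspace 'cV[F]_k}) r :
  (r <= k - \dim L)%N ->
  exists2 K : {vspace 'rV[F]_k}, \dim K = r &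
    forall u x, u \in K -> x \in L -> u *m x = 0.
Proof.
move=> le_r; pose B := \matrix_(i < k, j < \dim L) (vbasis L)`_j i 0.
pose f : 'Hom('rV[F]_k, 'rV[F]_(\dim L)) := linfun (mulmxr B).
have [|K sK dimK] := @subv_of_dim _ _ (lker f) r.
  have := limg_ker_dim f fullv; rewrite capfv dimvf /dim /= mul1n => def_k.
  apply: leq_trans le_r _; rewrite leq_subLR -{1}def_k addnC leq_add2r.
  by apply: leq_trans (dimvS (subvf _)) _; rewrite dimvf /dim /= mul1n.
exists K => // u x uK /coord_vbasis ->.
have: f u = 0 by apply/eqP; rewrite -memv_ker (subvP sK).
rewrite lfunE /= => uB0.
rewrite mulmx_sumr big1 // => j _; rewrite -scalemxAr.
suffices ->: u *m (vbasis L)`_j = 0 by rewrite scaler0.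
apply/matrixP=> a b; rewrite !ord1.
have /matrixP/(_ 0 j) := uB0; rewrite !mxE => {2}<-.
by apply: eq_bigr => i _; rewrite !mxE.
Qed.

(** Two increasing sequences of the same length l cannot have one set of values
    strictly inside the other, and an increasing sequence is determined by its
    values. *)
Lemma schubert_index_subset_eq l m (a p : schubert_index l m) :
  {subset val p <= val a} -> p = a.
Proof.
move=> sub_pa; apply/val_inj/val_inj => /=.
have srt (b : schubert_index l m) : sorted (relpre val ltn) (val b).
  by rewrite -sorted_map; exact: valP b.
have tr: transitive (relpre (@nat_of_ord m) ltn).
  by move=> y x z; apply: ltn_trans.
have irr: irreflexive (relpre (@nat_of_ord m) ltn) by move=> x /=; apply: ltnn.
apply: (irr_sorted_eq tr irr (srt p) (srt a)).
have up := sorted_uniq tr irr (srt p).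
by have [|_ //] := uniq_min_size up sub_pa; rewrite !size_tuple.
Qed.

Section GrassmannCode.

Variables (F : finFieldType) (l m : nat) (V : vectType F) (e : m.-tuple V).
Hypothesis e_basis : basis_of fullv e.

Definition coordinate_subspace (a : schubert_index l m) : {vspace V} :=
  <<[seq tnth e i | i <- val a]>>%VS.

Lemma dim_coordinate_subspace a : \dim (coordinate_subspace a) = l.
Proof.
have ua: uniq (val a).
  by rewrite -(map_inj_uniq val_inj) (sorted_uniq ltn_trans ltnn (valP a)).
have e_uniq := free_uniq (basis_free e_basis).
pose b := [seq tnth e i | i <- val a].
suffices /eqP-> : free b by rewrite size_map size_tuple.
have ub : uniq b.
  by rewrite map_inj_uniq // => i j /(tuple_uniqP _ e_uniq).
have : perm_eq [seq v <- e | v \in b] b.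
  apply: uniq_perm => //; first exact: filter_uniq.
  move=> v; rewrite mem_filter; apply: andb_idr.
  by case/mapP=> i _ ->; apply: mem_tnth.
move/perm_free <-; exact: filter_free (basis_free e_basis).
Qed.

Lemma coord_coordinate_subspace_out a v i :
  v \in coordinate_subspace a -> i \notin val a -> coord e i v = 0.
Proof.
move=> va ia.
suffices: (coordinate_subspace a <= lker (linfun (coord e i : V -> F^o)))%VS.
  by move/subvP/(_ v va); rewrite memv_ker lfunE => /eqP.
apply/span_subvP=> _ /mapP[j ja ->]; rewrite memv_ker lfunE /=.
rewrite (tnth_nth 0) coord_free ?(basis_free e_basis) //.
by have [ij|//] := eqVneq i j; rewrite ij ja in ia.
Qed.

(** Since p differs from a, some column of the p-minor is indexed outside a;
    that column is zero. *)
Lemma pluecker_coords_coordinate_subspace_off a (p : 'I_'C(m, l)) :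
  pluecker_index p != a ->
  pluecker_coords l e (vbasis (coordinate_subspace a)) p 0 = 0.
Proof.
move=> neq_pa.
have [j ja]: exists j, tnth (val (pluecker_index p)) j \notin val a.
  apply/existsP; rewrite -[X in is_true X]negbK negb_exists.
  apply: contra neq_pa => /forallP sub_pa; apply/eqP.
  apply: schubert_index_subset_eq => i /tnthP[j ->].
  by have := sub_pa j; rewrite negbK.
rewrite mxE (expand_det_col _ j) big1 // => i _.
rewrite mxE (coord_coordinate_subspace_out _ ja) ?mul0r //.
by apply/vbasis_mem/mem_nth; rewrite size_tuple dim_coordinate_subspace.
Qed.

(** A linear relation between the rows of the a-minor is a linear relation
    between the basis vectors, because their remaining coordinates vanish. *)
Lemma pluecker_coords_coordinate_subspace_diag a (p : 'I_'C(m, l)) :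
  pluecker_index p = a ->
  pluecker_coords l e (vbasis (coordinate_subspace a)) p 0 != 0.
Proof.
move=> def_a; rewrite mxE def_a; set M := (X in \det X).
have dimW := dim_coordinate_subspace a.
pose b : seq V := vbasis (coordinate_subspace a).
have b_free : free b := basis_free (vbasisP _).
have b_mem (i : 'I_l) : b`_i \in coordinate_subspace a.
  by apply/vbasis_mem/mem_nth; rewrite size_tuple dimW.
have [t def_t]: exists t : l.-tuple V, t = b :> seq V.
  have size_b: size b == l by rewrite size_tuple dimW.
  by exists (Tuple size_b).
rewrite -unitfE -unitmxE -row_free_unit; apply: inj_row_free => v vM0.
pose x := \sum_(i < l) v 0 i *: t`_i.
have xW: x \in coordinate_subspace a.
  by apply: memv_suml => i _; apply: memvZ; rewrite def_t.
have coord_x j : coord e j x = 0.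
  have [/tnthP[j' ->] | ja] := boolP (j \in val a); last first.
    exact: coord_coordinate_subspace_out xW ja.
  have /matrixP/(_ 0 j') := vM0; rewrite !mxE => <-.
  rewrite linear_sum; apply: eq_bigr => i _.
  by rewrite linearZ !mxE def_t.
have x0: x = 0.
  rewrite (coord_basis e_basis (memvf x)) big1 // => j _.
  by rewrite coord_x scale0r.
have /freeP free_t: free t by rewrite def_t.
by apply/rowP=> i; rewrite mxE; apply: free_t.
Qed.

(** No nonzero linear form vanishes at all the coordinate subspaces, hence on
    the whole Grassmannian. *)
Lemma generator_inj (G : 'M[F]_('C(m, l), #|grassmannian l V|)) :
  grassmann_generator_matrix e G ->
  injective (mulmxr G : 'rV_('C(m, l)) -> 'rV_#|grassmannian l V|).
Proof.
case=> w [w_inj w_in col_w]; apply: raddf_inj => u /= uG0.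
apply/rowP=> p; rewrite [RHS]mxE; pose a := pluecker_index p.
(* An injection into a set of the same cardinality hits every point. *)
have [j def_j]: exists j, w j = coordinate_subspace a.
  have card_w: #|w @: 'I_#|grassmannian l V| | = #|grassmannian l V|.
    by rewrite card_imset // card_ord.
  have /(subset_cardP card_w) im_w:
    w @: 'I_#|grassmannian l V| \subset grassmannian l V.
    by apply/subsetP=> _ /imsetP[j _ ->].
  have: coordinate_subspace a \in grassmannian l V.
    by rewrite inE dim_coordinate_subspace.
  by rewrite -im_w => /imsetP[j _ ->]; exists j.
pose c := pluecker_coords l e (vbasis (coordinate_subspace a)).
have [z def_c]: exists z, c = z *: col j G.
  by apply/vlineP; rewrite col_w def_j memv_line.
have uc0: u *m c = 0.
  by rewrite def_c -scalemxAr colE mulmxA uG0 mul0mx scaler0.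
have /matrixP/(_ 0 0) := uc0; rewrite !mxE (bigD1 p) //= big1 => [|p' neq_p].
  rewrite addr0 => /eqP; rewrite mulf_eq0 => /orP[/eqP // | ].
  by rewrite (negPf (pluecker_coords_coordinate_subspace_diag (erefl a))).
rewrite pluecker_coords_coordinate_subspace_off ?mulr0 //.
by apply: contra neq_p => /eqP/enum_val_inj/cast_ord_inj->.
Qed.

(** The map u |-> u *m G carries the forms vanishing on X to codewords whose
    supports avoid X; injectivity keeps the dimension of the subcode equal to r.
    Taken over all X this is d_r <= n - H_r. *)
Lemma higher_weight_le_codim (G : 'M[F]_('C(m, l), #|grassmannian l V|)) r
    (X : {set {vspace V}}) :
  grassmann_generator_matrix e G -> X \subset grassmannian l V ->
  (r <= pluecker_codim l e X)%N ->
  (higher_weight (code_of_generator G) r <= #|grassmannian l V| - #|X|)%N.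
Proof.
move=> G_gen sX codimX; have [w [w_inj w_in col_w]] := G_gen.
have [K dimK annK] := annihilator_exists codimX.
pose f : 'Hom('rV[F]_('C(m, l)), 'rV[F]_#|grassmannian l V|) :=
  linfun (mulmxr G).
have dimD: \dim (f @: K) = r.
  rewrite limg_dim_eq // (_ : lker f = 0%VS) ?capv0 //.
  apply/eqP/lker0P=> u v; rewrite !lfunE; exact: generator_inj.
have sDC: (f @: K <= code_of_generator G)%VS.
  apply/subvP=> _ /memv_imgP[u _ ->]; rewrite lfunE /= mulmx_sum_row.
  apply: memv_suml => i _; apply: memvZ; apply: memv_span.
  by apply: map_f; rewrite mem_enum.
apply: leq_trans (higher_weight_le sDC dimD) _.
have <-: #|grassmannian l V :\: X| = (#|grassmannian l V| - #|X|)%N.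
  by rewrite cardsD (setIidPr sX).
rewrite -(card_imset _ w_inj); apply/subset_leq_card/subsetP.
move=> _ /imsetP[j jD ->].
move: jD; rewrite inE => /existsP[_ /andP[/memv_imgP[u uK ->] fu_j]].
rewrite in_setD w_in andbT; apply: contra fu_j => wX.
have col_in: col j G \in pluecker_span l e X.
  apply: (subvP (sumv_sup (w j) wX (subvv _))).
  by rewrite -col_w memv_line.
have /matrixP/(_ 0 0) := annK _ _ uK col_in.
by rewrite colE mulmxA -colE lfunE !mxE => ->.
Qed.

End GrassmannCode.

Theorem proposition4p10 (F : finFieldType) (l m : nat) (V : vectType F)
    (e : m.-tuple V) (G : 'M[F]_('C(m, l), #|grassmannian l V|)) (r : nat)
    (l_gt0 : (1 <= l)%N) (l_lt_m : (l < m)%N) (e_basis : basis_of fullv e)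
    (G_gen : grassmann_generator_matrix e G) (r_bounds : (1 <= r <= 'C(m, l))%N) :
  (higher_weight (code_of_generator G) r <= schubert_D l e r)%N.
Proof.
rewrite /schubert_D /schubert_J.
(* The empty union spans a space of codimension 'C(m, l), so the maximum is
   attained. *)
have codim0:
  (r <= pluecker_codim l e (schubert_union e (@set0 (schubert_index l m))))%N.
  rewrite /pluecker_codim /schubert_union big_set0 /pluecker_span big_set0.
  by rewrite dimv0 subn0; case/andP: r_bounds.
rewrite (bigmax_eq_arg set0 codim0).
case: arg_maxnP => // S codimS _.
apply: (higher_weight_le_codim e_basis) => //; rewrite /schubert_union.
by apply/bigcupsP=> a _; apply/subsetP=> W; rewrite inE => /andP[].
Qed.
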